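(* Let $p$ be a prime and let $G$ be a subgroup of $\mathrm{PSL}(2,\mathbb{C}_p)$. If the limit set of $G$ is empty, then $G$ has potentially good reduction.
   Context: $\mathbb{C}_p$ is the completion of the algebraic closure of $\mathbb{Q}_p$; $\mathcal{O}_p=\{z\in\mathbb{C}_p:|z|\le1\}$, $k$ is its residue field. $\mathrm{PSL}(2,\mathbb{C}_p)=\mathrm{SL}(2,\mathbb{C}_p)/\{\pm I\}$ acts on $\mathbb{P}^1(\mathbb{C}_p)=\mathbb{C}_p\cup\{\infty\}$ by Möbius maps. $\mathbb{P}^1(\mathbb{C}_p)$ carries the topology of the chordal metric $\rho_v(z,w)=\frac{|z-w|}{\max\{1,|z|\}\max\{1,|w|\}}$ ($z,w\in\mathbb{C}_p$), $\rho_v(\infty,w)=\rho_v(w,\infty)=\frac1{\max\{1,|w|\}}$ for $w\in\mathbb{C}_p$, $\rho_v(\infty,\infty)=0$. A point $a\in\mathbb{P}^1(\mathbb{C}_p)$ is a limit point of $G$ if there exist a point $b\in\mathbb{P}^1(\mathbb{C}_p)$ and an infinite sequence $\{g_n: n\ge1\}\subset G$, with $g_n\ne g_m$ for $n\ne m$, such that $\lim g_n(b)=a$. The limit set of $G$ is the set of all its limit points. Good reduction: write a rational map $f\in\mathbb{C}_p(z)$ of degree $d$ in homogeneous coordinates as $f([x,y])=[g(x,y),h(x,y)]$ with $g,h\in\mathcal{O}_p[x,y]$ relatively prime homogeneous of degree $d$ and at least one coefficient of $g$ or $h$ of absolute value $1$. Then $f$ has good reduction if the reductions $\bar g,\bar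 h$ have no common zero in $k\times k$ besides $(0,0)$. A subgroup $G$ of $\mathrm{PSL}(2,\mathbb{C}_p)$ has potentially good reduction if there is $h\in\mathrm{PSL}(2,\mathbb{C}_p)$ such that $h^{-1}gh$ has good reduction for every $g\in G$. *)

(* Defs.v *)
From HB Require Import structures.
From mathcomp Require Import all_boot all_order all_algebra.
From mathcomp Require Import boolp classical_sets reals topology.
From mathcomp Require Import mpoly.

Set Implicit Arguments.
Unset Strict Implicit.
Unset Printing Implicit Defensive.

Import Order.TTheory GRing.Theory Num.Theory.
Import numFieldTopology.Exports.
Local Open Scope classical_set_scope.
Local Open Scope ring_scope.
Local Open Scope quotient_scope.

Record nonarch_abs (R : realType) (K : fieldType) := NonarchAbs {
  abs_val :> K -> R;
  abs_ge0 : forall x, 0 <= abs_val x;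
  abs_eq0 : forall x, (abs_val x == 0) = (x == 0);
  absM : forall x y, abs_val (x * y) = abs_val x * abs_val y;
  absD : forall x y, abs_val (x + y) <= Num.max (abs_val x) (abs_val y) }.

Section AbsTheory.
Context (R : realType) (K : fieldType) (v : nonarch_abs R K).

Lemma abs0 : v 0 = 0. Proof. by apply/eqP; rewrite abs_eq0. Qed.

Lemma abs1 : v 1 = 1.
Proof.
have n0 : v 1 != 0 by rewrite abs_eq0 oner_eq0.
by apply: (mulfI n0); rewrite -absM !mulr1.
Qed.

Lemma absN1 : v (-1) = 1.
Proof.
apply/eqP; rewrite -(@pexpr_eq1 _ _ 2) ?abs_ge0 //.
by rewrite expr2 -absM mulrNN mulr1 abs1.
Qed.

Lemma absN x : v (- x) = v x.
Proof. by rewrite -mulN1r absM absN1 mul1r. Qed.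

End AbsTheory.

Definition padic_abs (R : realType) (p : nat) (x : rat) : R :=
  if x == 0 then 0
  else p%:R ^ ((logn p `|denq x|)%:Z - (logn p `|numq x|)%:Z).

Section Completion.
Context (R : realType).

Definition complete_abs (K : fieldType) (v : K -> R) : Prop :=
  forall u : nat -> K,
    (forall e : R, 0 < e -> exists N : nat,
       forall m n, (N <= m)%N -> (N <= n)%N -> v (u m - u n) < e) ->
    exists l : K, (fun n => v (u n - l)) @ \oo --> (0 : R).

Definition dense_image (F K : fieldType) (v : K -> R) (i : F -> K) : Prop :=
  forall (x : K) (e : R), 0 < e -> exists y : F, v (x - i y) < e.

Definition is_completion (F K : fieldType) (vF : F -> R) (vK : K -> R)
    (i : {rmorphism F -> K}) : Prop :=
  [/\ forall x, vK (i x) = vF x, dense_image vK i & complete_abs vK].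

Definition is_alg_closure (F : fieldType) (L : closedFieldType)
    (i : {rmorphism F -> L}) : Prop :=
  forall x : L, algebraicOver i x.

(* [C] with absolute value [v] is a completion of an algebraic closure of Q_p,
   where Q_p is a completion of the rationals for the p-adic absolute value
   and the absolute value of its algebraic closure extends that of Q_p.
   Such a [C] is unique up to isometric isomorphism. *)
Definition is_Cp (p : nat) (C : fieldType) (v : nonarch_abs R C) : Prop :=
  exists (Qp : fieldType) (vQp : nonarch_abs R Qp) (i : {rmorphism rat -> Qp})
         (Qpbar : closedFieldType) (vQpbar : nonarch_abs R Qpbar)
         (j : {rmorphism Qp -> Qpbar}) (k : {rmorphism Qpbar -> C}),
  [/\ is_completion (padic_abs R p) vQp i,
      is_alg_closure j,
      forall x, vQpbar (j x) = vQp x &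
      is_completion vQpbar v k].

End Completion.

Section ResidueField.
Context (R : realType) (K : fieldType) (v : nonarch_abs R K).

Definition integers_pred : pred K := fun z => v z <= 1.

Lemma integers_subring_closed : subring_closed integers_pred.
Proof.
split; rewrite /in_mem /= /integers_pred ?abs1 // => x y; rewrite /in_mem /=.
  move=> vx vy; apply: le_trans (absD _ _ _) _.
  by rewrite ge_max absN vx vy.
by move=> vx vy; rewrite absM mulr_ile1 ?abs_ge0.
Qed.

HB.instance Definition _ :=
  GRing.isSubringClosed.Build K integers_pred integers_subring_closed.

Record integers := Integer { int_val :> K; _ : int_val \in integers_pred }.

HB.instance Definition _ := [isSub for int_val].
HB.instance Definition _ := [Choice of integers by <:].
HB.instance Definition _ := [SubChoice_isSubComNzRing of integers by <:].

Definition max_ideal : pred integers := fun z => v (val z) < 1.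

Lemma max_ideal_closed : idealr_closed max_ideal.
Proof.
split; first by rewrite /in_mem /= /max_ideal rmorph0 abs0.
  by rewrite /in_mem /= /max_ideal rmorph1 abs1 ltxx.
move=> a x y; rewrite /in_mem /= => vx vy.
rewrite /max_ideal rmorphD rmorphM; apply: le_lt_trans (absD _ _ _) _.
rewrite gt_max [X in _ && X]vy absM andbT; apply: le_lt_trans vx.
by rewrite ler_piMl ?abs_ge0 //; apply: (valP a).
Qed.

HB.instance Definition _ := isIdealr.Build integers max_ideal max_ideal_closed.

Definition residue_field := {ideal_quot (max_ideal : idealr integers)}.
HB.instance Definition _ := GRing.ComNzRing.on residue_field.

Definition reduction (z : integers) : residue_field := \pi_residue_field z.

End ResidueField.

Section ProjectiveLine.
Context (K : fieldType).

(* [Some z] is the finite point z, [None] is the point at infinity. *)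
Definition P1 : Type := option K.

(* The junk value at (0, 0) is the point at infinity. *)
Definition proj_pt (x y : K) : P1 := if y == 0 then None else Some (x / y).

End ProjectiveLine.
Arguments proj_pt {K}.

Section PSL2.
Context (K : fieldType).

Record SL2 := MkSL2 { SL2_val :> 'M[K]_2; _ : \det SL2_val == 1 }.

HB.instance Definition _ := [isSub for SL2_val].
HB.instance Definition _ := [Choice of SL2 by <:].

Lemma det_SL2 (A : SL2) : \det A = 1. Proof. exact/eqP/(valP A). Qed.

Lemma SL2_unit (A : SL2) : (A : 'M_2) \in unitmx.
Proof. by rewrite unitmxE det_SL2 unitr1. Qed.

Lemma SL2_one_subproof : \det (1%:M : 'M[K]_2) == 1.
Proof. by rewrite det1. Qed.
Lemma SL2_mul_subproof (A B : SL2) : \det (A *m B) == 1.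
Proof. by rewrite det_mulmx !det_SL2 mulr1. Qed.
Lemma SL2_inv_subproof (A : SL2) : \det (invmx A) == 1.
Proof. by rewrite det_inv det_SL2 invr1. Qed.
Lemma SL2_opp_subproof (A : SL2) : \det (- (A : 'M_2)) == 1.
Proof. by rewrite -scaleN1r detZ det_SL2 mulr1 expr2 mulrNN mulr1. Qed.

Definition SL2_one := MkSL2 SL2_one_subproof.
Definition SL2_mul A B := MkSL2 (SL2_mul_subproof A B).
Definition SL2_inv A := MkSL2 (SL2_inv_subproof A).
Definition SL2_opp A := MkSL2 (SL2_opp_subproof A).

Lemma SL2_mulA : associative SL2_mul.
Proof. by move=> A B C; apply: val_inj; rewrite /= mulmxA. Qed.
Lemma SL2_mul1 : left_id SL2_one SL2_mul.
Proof. by move=> A; apply: val_inj; rewrite /= mul1mx. Qed.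
Lemma SL2_mulr1 : right_id SL2_one SL2_mul.
Proof. by move=> A; apply: val_inj; rewrite /= mulmx1. Qed.
Lemma SL2_mulV : left_inverse SL2_one SL2_inv SL2_mul.
Proof. by move=> A; apply: val_inj; rewrite /= mulVmx ?SL2_unit. Qed.
Lemma SL2_mulrV : right_inverse SL2_one SL2_inv SL2_mul.
Proof. by move=> A; apply: val_inj; rewrite /= mulmxV ?SL2_unit. Qed.

HB.instance Definition _ :=
  isGroup.Build SL2 SL2_mulA SL2_mul1 SL2_mulr1 SL2_mulV SL2_mulrV.

Definition eq_sign (A B : SL2) : bool := (A == B) || (A == SL2_opp B).

Lemma SL2_oppK : involutive SL2_opp.
Proof. by move=> A; apply: val_inj; rewrite /= opprK. Qed.

Lemma eq_sign_equiv : equiv_class_of eq_sign.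
Proof.
split=> [A|A B|B A C]; rewrite /eq_sign ?eqxx //.
  by rewrite eq_sym [A == SL2_opp B]eq_sym (can2_eq SL2_oppK SL2_oppK).
by case/orP=> /eqP-> /orP[]/eqP->; rewrite ?SL2_oppK eqxx ?orbT.
Qed.

Canonical eq_sign_rel := EquivRelPack eq_sign_equiv.

Definition PSL2 := {eq_quot eq_sign_rel}.
HB.instance Definition _ := Choice.on PSL2.
HB.instance Definition _ := EqQuotient.on PSL2.

Definition PSL2_one : PSL2 := \pi_PSL2 1%g.
Definition PSL2_mul (g h : PSL2) : PSL2 := \pi_PSL2 (repr g * repr h)%g.
Definition PSL2_inv (g : PSL2) : PSL2 := \pi_PSL2 (repr g)^-1%g.

Lemma PSL2_eqP (A B : SL2) :
  reflect (A = B \/ A = SL2_opp B) (\pi_PSL2 A == \pi_PSL2 B).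
Proof.
rewrite eqmodE /= /eq_sign.
by apply: (iffP orP) => -[/eqP h|/eqP h]; [left|right|left|right].
Qed.

Lemma repr_pi (A : SL2) :
  repr (\pi_PSL2 A) = A \/ repr (\pi_PSL2 A) = SL2_opp A.
Proof. by apply/PSL2_eqP; rewrite reprK. Qed.

Lemma pi_opp (A : SL2) : \pi_PSL2 (SL2_opp A) = \pi_PSL2 A.
Proof. by apply/eqP/PSL2_eqP; right. Qed.

Lemma SL2_mulN (A B : SL2) : (A * SL2_opp B = SL2_opp (A * B))%g.
Proof. by apply: val_inj; rewrite /= mulmxN. Qed.
Lemma SL2_mulNr (A B : SL2) : (SL2_opp A * B = SL2_opp (A * B))%g.
Proof. by apply: val_inj; rewrite /= mulNmx. Qed.
Lemma SL2_invN (A : SL2) : ((SL2_opp A)^-1 = SL2_opp A^-1)%g.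
Proof.
apply: (@mulgI _ (SL2_opp A)); rewrite mulgV SL2_mulN SL2_mulNr SL2_oppK.
by rewrite mulgV.
Qed.

Lemma pi_mul (A B : SL2) :
  PSL2_mul (\pi_PSL2 A) (\pi_PSL2 B) = \pi_PSL2 (A * B)%g.
Proof.
rewrite /PSL2_mul; case: (repr_pi A) => ->; case: (repr_pi B) => ->;
  by rewrite ?SL2_mulN ?SL2_mulNr ?SL2_oppK ?pi_opp.
Qed.

Lemma pi_inv (A : SL2) : PSL2_inv (\pi_PSL2 A) = \pi_PSL2 A^-1%g.
Proof.
by rewrite /PSL2_inv; case: (repr_pi A) => ->; rewrite ?SL2_invN ?pi_opp.
Qed.

Lemma PSL2_mulA : associative PSL2_mul.
Proof.
elim/quotW=> A; elim/quotW=> B; elim/quotW=> C.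
by rewrite (pi_mul A B) (pi_mul B C) (pi_mul A) (pi_mul _ C) mulgA.
Qed.
Lemma PSL2_mul1 : left_id PSL2_one PSL2_mul.
Proof. by elim/quotW=> A; rewrite (pi_mul 1%g A) mul1g. Qed.
Lemma PSL2_mulr1 : right_id PSL2_one PSL2_mul.
Proof. by elim/quotW=> A; rewrite (pi_mul A 1%g) mulg1. Qed.
Lemma PSL2_mulV : left_inverse PSL2_one PSL2_inv PSL2_mul.
Proof. by elim/quotW=> A; rewrite (pi_inv A) (pi_mul _ A) mulVg. Qed.
Lemma PSL2_mulrV : right_inverse PSL2_one PSL2_inv PSL2_mul.
Proof. by elim/quotW=> A; rewrite (pi_inv A) (pi_mul A) mulgV. Qed.

HB.instance Definition _ :=
  isGroup.Build PSL2 PSL2_mulA PSL2_mul1 PSL2_mulr1 PSL2_mulV PSL2_mulrV.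

(* z |-> (a z + b) / (c z + d) for A = [a, b; c, d] *)
Definition mobius (A : 'M[K]_2) (z : P1 K) : P1 K :=
  if z is Some z then proj_pt (A 0 0 * z + A 0 1) (A 1 0 * z + A 1 1)
  else proj_pt (A 0 0) (A 1 0).

Lemma mobiusN (A : 'M[K]_2) : mobius (- A) =1 mobius A.
Proof.
have projN x y : proj_pt (- x) (- y) = proj_pt x y :> P1 K.
  by rewrite /proj_pt oppr_eq0 invrN mulrNN.
by case=> [z|]; rewrite /= !mxE ?mulNr -?opprD projN.
Qed.

Definition PSL2_act (g : PSL2) : P1 K -> P1 K := mobius (repr g).

Lemma PSL2_actE (A : SL2) : PSL2_act (\pi_PSL2 A) =1 mobius A.
Proof.
by rewrite /PSL2_act => z; case: (repr_pi A) => -> //; rewrite mobiusN.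
Qed.

End PSL2.

Section LimitSet.
Context (R : realType) (K : fieldType) (v : nonarch_abs R K).

Definition chordal (z w : P1 K) : R :=
  match z, w with
  | Some z, Some w => v (z - w) / (Num.max 1 (v z) * Num.max 1 (v w))
  | None, Some w | Some w, None => 1 / Num.max 1 (v w)
  | None, None => 0
  end.

Definition limit_point (G : set (PSL2 K)) (a : P1 K) : Prop :=
  exists (b : P1 K) (g : nat -> PSL2 K),
    [/\ forall n, G (g n), injective g &
        (fun n => chordal (PSL2_act (g n) b) a) @ \oo --> (0 : R)].

Definition limit_set (G : set (PSL2 K)) : set (P1 K) :=
  [set a | limit_point G a].

End LimitSet.

Section GoodReduction.
Context (R : realType) (K : fieldType) (v : nonarch_abs R K).

Notation Ov := (integers v).
Notation k := (residue_field v).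

Definition pt2 (T : Type) (x y : T) (i : 'I_2) : T := if i == 0 then x else y.

Definition rel_prime (g h : {mpoly K[2]}) : Prop :=
  forall q a b : {mpoly K[2]}, g = q * a -> h = q * b -> q \is a GRing.unit.

(* The pair (g, h) is determined by f up to a common unit of Ov, so the choice
   of a normalized form is immaterial in [good_reduction]. *)
Definition normalized_form (f : P1 K -> P1 K) (d : nat)
    (g h : {mpoly Ov[2]}) : Prop :=
  let gK := map_mpoly (@int_val _ _ v) g in
  let hK := map_mpoly (@int_val _ _ v) h in
  [/\ g \is d.-homog /\ h \is d.-homog,
      rel_prime gK hK,
      exists m, v (int_val g@_m) = 1 \/ v (int_val h@_m) = 1 &
      forall x y : K, (x, y) != (0, 0) ->
        f (proj_pt x y) = proj_pt gK.@[pt2 x y] hK.@[pt2 x y]].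

Definition good_reduction (f : P1 K -> P1 K) : Prop :=
  exists (d : nat) (g h : {mpoly Ov[2]}),
    normalized_form f d g h /\
    forall x y : k,
      (map_mpoly (@reduction _ _ v) g).@[pt2 x y] = 0 ->
      (map_mpoly (@reduction _ _ v) h).@[pt2 x y] = 0 -> x = 0 /\ y = 0.

Definition potentially_good_reduction (G : set (PSL2 K)) : Prop :=
  exists h : PSL2 K, forall g, G g ->
    good_reduction (PSL2_act (h^-1 * g * h)%g).

End GoodReduction.

Definition is_subgroup (K : fieldType) (G : set (PSL2 K)) : Prop :=
  [/\ G 1%g, forall g h, G g -> G h -> G (g * h)%g &
      forall g, G g -> G g^-1%g].

(* Main.v *)
Require Import Defs.
From mathcomp Require Import all_boot all_order all_algebra all_solvable all_field.
From mathcomp Require Import zify ring.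
From mathcomp Require Import boolp classical_sets functions cardinality reals.
From mathcomp Require Import topology mpoly.

Set Implicit Arguments.
Unset Strict Implicit.
Unset Printing Implicit Defensive.

Import Order.TTheory GRing.Theory Num.Theory.
Import numFieldTopology.Exports.
Local Open Scope classical_set_scope.
Local Open Scope ring_scope.
Local Open Scope quotient_scope.

(** A subgroup with empty limit set is finite, and a finite subgroup preserves
    a free rank two lattice over the ring of integers; a basis of that lattice
    conjugates the subgroup into matrices with integral entries, whose two rows
    are linear forms witnessing good reduction
    ([finite_invariant_lattice], [good_reduction_integral]).

    The first step towards finiteness is that a point b fixed by infinitely
    many elements is a limit point, because an injective sequence of such
    elements moves b along a constant sequence ([finite_stabilizer]).  Every
    unimodular 2 x 2 matrix over Cp has an eigenvector, as square roots exist
    ([completion_sqrt]); hence all powers of an element lie in one finite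
    stabilizer and the group is torsion ([tame_torsion]).  In particular every
    trace has the form u + 1/u with u a root of unity.

    Torsion is turned into finiteness by an arithmetic argument.  Write an
    element g other than 1 and -1 as diag(l, 1/l) and let h be an element with
    entries a, b, c, d in the same basis.  The traces of the commutator of g
    and h and of g h g h^-1 are
      2 - b c (l - 1/l)^2   and   2 + a d (l - 1/l)^2,
    so, writing them as u + 1/u and s + 1/s, and t = l^2, the equality
    a d - b c = 1 becomes
      (2 - u - 1/u) + (2 - s - 1/s) = 2 - t - 1/t.
    This relation between roots of unity can be read in the complex numbers,
    where it says |1 - u|^2 + |1 - s|^2 = |1 - t|^2, and it holds for all
    Galois conjugates.  If u and s differ from 1, then
    2 |1 - u| |1 - s| <= |1 - t|^2; in the product over all conjugates, the
    norms of 1 - u and 1 - s are nonzero integers, while the norm of 1 - t is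
    small because the product of the 1 - t^i for 0 < i < m is m, where m is the
    order of t.  The outcome is 2^(m - 1) <= m^2, that is m <= 6
    ([unity_sum_order]), so l has order dividing 120 ([tame_order]).

    Two cases remain ([tame_finite]).  Either some g is such that b c = 0 or
    a d = 0 for all h; then each element fixes one of the two fixed
    points of g or exchanges them, and finiteness of stabilizers concludes ([tame_finite_split]).
    Or every element has order dividing 120; then there are finitely many
    traces, and an element is determined by its traces against the basis
    1, g, h, g h of the matrix algebra ([tame_finite_bounded]). *)

(** * Norms in cyclotomic fields *)

Local Notation zhorner P x := ((map_poly intr (P : {poly int})).[x]).

Lemma root_Cyclotomic (F : fieldType) (n : nat) (z : F) :
  n.-primitive_root z -> zhorner (Cyclotomic n) z = 0.
Proof.
move=> prim_z; have n_gt0 := prim_order_gt0 prim_z.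
have: zhorner (\prod_(d <- divisors n) Cyclotomic d) z = 0.
  rewrite prod_Cyclotomic // rmorphB rmorph1 /= map_polyXn !hornerE.
  by rewrite (prim_expr_order prim_z) subrr.
rewrite rmorph_prod horner_prod => /eqP; rewrite prodf_seq_eq0 => /hasP[d].
rewrite -dvdn_divisors // => d_dv_n /= /eqP Phi_d0.
have d_gt0 := dvdn_gt0 n_gt0 d_dv_n.
suff zd1 : z ^+ d = 1.
  have n_dv_d : (n %| d)%N by rewrite (prim_order_dvd prim_z) zd1.
  by have /eqP -> : n == d by rewrite eqn_dvd n_dv_d.
have: zhorner (\prod_(e <- divisors d) Cyclotomic e) z = 0.
  rewrite (big_rem d) -?dvdn_divisors //= rmorphM hornerM.
  by rewrite Phi_d0 mul0r.
rewrite prod_Cyclotomic // rmorphB rmorph1 /= map_polyXn !hornerE.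
by move/eqP; rewrite subr_eq0 => /eqP.
Qed.

(** Irreducibility of cyclotomic polynomials: an integral relation satisfied by
    one primitive root of unity is satisfied by all of them, even across fields.
    It brings relations in Cp to the complex numbers, and to every conjugate. *)
Lemma zhorner_transfer (F : fieldType) (f : {rmorphism rat -> F}) (n : nat)
    (z : F) (w : algC) (P : {poly int}) :
  n.-primitive_root z -> n.-primitive_root w ->
  zhorner P z = 0 -> zhorner P w = 0.
Proof.
move=> prim_z prim_w Pz0.
have mapf (q : {poly int}) : map_poly intr q = map_poly f (map_poly intr q).
  by rewrite -map_poly_comp; apply: eq_map_poly => a; rewrite /= rmorph_int.
have mapC (q : {poly int}) :
    map_poly intr q = map_poly (@ratr algC) (map_poly intr q).
  by rewrite -map_poly_comp; apply: eq_map_poly => a; rewrite /= rmorph_int.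
have [q [Dq mon_q] dv_q] := minCpolyP w.
have {Dq} Dq : q = map_poly intr (Cyclotomic n).
  apply: (map_inj_poly (fmorph_inj (@ratr algC))); first exact: rmorph0.
  by rewrite -Dq -mapC (minCpoly_cyclotomic prim_w) (Cintr_Cyclotomic prim_w).
have Pw : root (map_poly ratr (map_poly intr P)) w = (q %| map_poly intr P).
  exact: dv_q.
suff: q %| map_poly intr P by rewrite -Pw -mapC => /rootP.
set p := map_poly intr P in Pw *.
(* The minimal polynomial q of w divides d = gcd(q, p) or q / d.  In the second
   case d = 1, and a Bezout relation contradicts the common root z. *)
pose d := gcdp q p; have d_dv_q : d %| q := dvdp_gcdl _ _.
have d_dv_p : d %| p := dvdp_gcdr _ _.
have /orP[dw|ew] : root (map_poly ratr d) w || root (map_poly ratr (q %/ d)) w.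
  by rewrite -rootM -rmorphM /= mulrC divpK // dv_q.
  by apply: dvdp_trans d_dv_p; rewrite -dv_q.
have sz_d : size d = 1.
  have q0 : q != 0 by rewrite monic_neq0.
  have d0 : d != 0 by apply: contraNneq q0 => d0; rewrite -dvd0p -d0.
  have e0 : q %/ d != 0 by rewrite dvdp_div_eq0.
  move: ew; rewrite dv_q => /(dvdp_leq e0); rewrite size_divp // leq_subRL.
    case: (size d) (size_poly_eq0 d) => [|[|m]] //; rewrite (negPf d0) //.
    by rewrite /= -{2}[size q]add0n leq_add2r.
  by rewrite (leq_trans (leq_pred _)) // dvdp_leq.
have: coprimep q p by rewrite coprimep_def sz_d.
rewrite -(coprimep_map f) => /coprimep_root; move/(_ z).
by rewrite Dq /p -!mapf /root root_Cyclotomic // Pz0 eqxx => /(_ isT).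
Qed.

Section Norm.
Context (n : nat) (w : algC).
Hypothesis prim_w : n.-primitive_root w.
Let n_gt0 := prim_order_gt0 prim_w.

(** The norm, from the n-th cyclotomic field to the rationals, of P evaluated at
    w. *)
Definition cyc_norm (P : {poly int}) : algC :=
  \prod_(k < n | coprime k n) zhorner P (w ^+ k).

(** Modulo the cyclotomic polynomial, the product of the P('X^k) is a polynomial
    of degree less than the number of conjugates of w that takes the same value
    at each of them: it is a constant, and it has integral coefficients. *)
Lemma cyc_norm_int P : cyc_norm P \in Num.int.
Proof.
pose F := \prod_(k < n | coprime k n) (P \Po 'X^k).
have Fw j : coprime j n -> zhorner F (w ^+ j) = cyc_norm P.
  move=> co_j; rewrite rmorph_prod horner_prod /=.
  (* Multiplication by j permutes the exponents prime to n. *)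
  pose h (k : 'I_n) := Ordinal (ltn_pmod (k * j) n_gt0).
  have inj_h : injective h.
    apply: can_inj (fun k : 'I_n => Ordinal (ltn_pmod (k * (egcdn j n).1) n_gt0)) _ => k.
    apply: val_inj => /=; rewrite modnMml -mulnA -modnMmr -{1}(mul1n j).
    by rewrite (chinese_modr co_j 0) modnMmr muln1 modn_small.
  rewrite /cyc_norm [RHS](reindex_inj inj_h); apply: eq_big => [k|k _] /=.
    by rewrite coprime_modl coprimeMl co_j andbT.
  rewrite map_comp_poly map_polyXn horner_comp hornerXn.
  by rewrite prim_expr_mod // mulnC exprM.
have mon_Phi := Cyclotomic_monic n.
pose r := Pdiv.Ring.rmodp F (Cyclotomic n).
have rw j : coprime j n -> zhorner r (w ^+ j) = cyc_norm P.
  move=> co_j; rewrite -(Fw j co_j) [in RHS](Pdiv.RingMonic.rdivp_eq mon_Phi F).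
  rewrite rmorphD rmorphM hornerD hornerM root_Cyclotomic ?mulr0 ?add0r //.
  by rewrite prim_root_exp_coprime.
have sz_r : (size r <= totient n)%N.
  have := Pdiv.Ring.ltn_rmodp F (Cyclotomic n).
  by rewrite monic_neq0 // size_Cyclotomic ltnS.
pose q : {poly algC} := map_poly intr r - (cyc_norm P)%:P.
suff: q == 0.
  rewrite /q subr_eq0 => /eqP /(congr1 (fun s : {poly algC} => s`_0)).
  by rewrite coef_map coefC /= => <-; rewrite intr_int.
have tot_gt0 : (0 < totient n)%N by rewrite totient_gt0.
apply/eqP; apply: (@roots_geq_poly_eq0 _ q
   [seq w ^+ k | k : 'I_n in [pred k : 'I_n | coprime k n]]).
- apply/allP => x /fintype.imageP[k co_k ->].
  by rewrite /root hornerD hornerN hornerC rw ?subrr.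
- rewrite map_inj_in_uniq ?enum_uniq // => i j _ _ /eqP.
  by rewrite (eq_prim_root_expr prim_w) !modn_small // => /eqP/val_inj.
rewrite size_map -cardE.
have -> : #|[pred k : 'I_n | coprime k n]| = totient n.
  rewrite totient_count_coprime -big_mkcond big_mkord -sum1_card.
  by apply: eq_bigl => k; rewrite coprime_sym.
rewrite (leq_trans (size_polyD _ _)) // geq_max size_polyN.
rewrite (leq_trans (size_poly _ _)) //.
by rewrite (leq_trans (size_polyC_leq1 _)).
Qed.

Lemma cyc_norm_ge1 (P : {poly int}) :
  (forall k, coprime k n -> zhorner P (w ^+ k) != 0) -> 1 <= `|cyc_norm P|.
Proof.
move=> P0; apply: norm_intr_ge1; first exact: cyc_norm_int.
by apply/prodf_neq0 => k co_k; apply: P0.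
Qed.

Lemma cyc_normM P Q : cyc_norm (P * Q) = cyc_norm P * cyc_norm Q.
Proof.
by rewrite /cyc_norm -big_split; apply: eq_bigr => k _; rewrite rmorphM hornerM.
Qed.

End Norm.

Lemma prod_prim_root_sub1 (F : fieldType) (m : nat) (t : F) :
  m.+1.-primitive_root t -> \prod_(i < m) (t ^+ i.+1 - 1) = (-1) ^+ m * m.+1%:R.
Proof.
move=> prim_t.
have: ('X - 1) * \prod_(i < m) ('X - (t ^+ i.+1)%:P) = 'X^(m.+1) - 1.
  by rewrite -(factor_Xn_sub_1 prim_t) big_mkord big_ord_recl expr0 polyC1.
rewrite subrX1 => /mulfI; rewrite polyXsubC_eq0 => /(_ isT)/(congr1 (horner^~ 1)).
have -> : (\sum_(i < m.+1) 'X^i).[1] = m.+1%:R :> F.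
  rewrite horner_sum -[m.+1 in RHS]card_ord -sumr_const.
  by apply: eq_bigr => i _; rewrite hornerXn expr1n.
rewrite horner_prod => <-.
rewrite -[in (-1) ^+ m](card_ord m) -prodr_const -big_split /=.
by apply: eq_bigr => i _; rewrite !hornerE mulN1r opprB.
Qed.

(** * A relation between three roots of unity *)

Lemma ltn_sqr_expn2 m : (6 < m)%N -> (m ^ 2 < 2 ^ m.-1)%N.
Proof.
move=> m_gt6; suff le k : ((k + 7) ^ 2 < 2 ^ (k + 6))%N.
  have -> : m = ((m - 7) + 7)%N by rewrite subnK.
  by rewrite [in (_ + 7).-1]addnS.
elim: k => // k; rewrite !addSn (expnS 2) -!mulnn; nia.
Qed.

Lemma zhornerX1 (R : comNzRingType) a (x : R) : zhorner ('X^a - 1) x = x ^+ a - 1.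
Proof. by rewrite rmorphB rmorph1 /= map_polyXn !hornerE. Qed.

Section ThreeRoots.
Context (n : nat) (w : algC).
Hypothesis prim_w : n.-primitive_root w.
Let n_gt0 := prim_order_gt0 prim_w.
Local Notation N a := (cyc_norm n w ('X^a - 1)).
Let e := #|[pred k : 'I_n | coprime k n]|.

Lemma prim_root_coprime_neq1 k a :
  coprime k n -> w ^+ a != 1 -> (w ^+ k) ^+ a != 1.
Proof.
move=> co_k; rewrite -(prim_order_dvd prim_w) -exprM -(prim_order_dvd prim_w).
by rewrite Gauss_dvdr // coprime_sym.
Qed.

Lemma cyc_norm_unity_ge1 a : w ^+ a != 1 -> 1 <= `|N a|.
Proof.
move=> wa1; apply: cyc_norm_ge1 => // k co_k.
by rewrite zhornerX1 subr_eq0 prim_root_coprime_neq1.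
Qed.

(** x^a - 1 divides x^(a i) - 1, and the norm of the quotient is a nonzero
    integer. *)
Lemma cyc_norm_unity_le a i : w ^+ (a * i) != 1 -> `|N a| <= `|N (a * i)|.
Proof.
move=> wai.
have -> : 'X^(a * i) - 1 = ('X^a - 1) * \sum_(j < i) ('X^a) ^+ j :> {poly int}.
  by rewrite exprM subrX1.
rewrite cyc_normM normrM ler_peMr // cyc_norm_ge1 // => k co_k.
apply: contraNneq (prim_root_coprime_neq1 co_k wai) => sum0.
by rewrite -subr_eq0 -zhornerX1 exprM subrX1 rmorphM hornerM sum0 mulr0.
Qed.

(** Each of the m - 1 norms of t^i - 1, where t = w^a and 0 < i < m, is at least
    that of t - 1, and their product is the norm of the integer m. *)
Lemma cyc_norm_unity_pow a m :
  m.-primitive_root (w ^+ a) -> `|N a| ^+ m.-1 <= m%:R ^+ e.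
Proof.
move=> prim_wa; have := prim_order_gt0 prim_wa.
case: m prim_wa => // m prim_wa _ /=.
have -> : m.+1%:R ^+ e = \prod_(i < m) `|N (a * i.+1)|.
  rewrite -normr_prod exchange_big /= normr_prod.
  rewrite -prodr_const; apply: eq_bigr => k co_k.
  rewrite (eq_bigr (fun i : 'I_m => ((w ^+ k) ^+ a) ^+ i.+1 - 1)); last first.
    by move=> i _; rewrite zhornerX1 exprM.
  rewrite prod_prim_root_sub1 ?normrM ?normrX ?normrN1 ?expr1n ?mul1r ?normr_nat //.
  rewrite exprAC prim_root_exp_coprime //.
  apply: coprime_dvdr co_k; rewrite (prim_order_dvd prim_wa) -exprM mulnC exprM.
  by rewrite (prim_expr_order prim_w) expr1n.
rewrite -[m in X in X <= _](card_ord m) -prodr_const.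
apply: ler_prod => i _; rewrite normr_ge0 cyc_norm_unity_le // exprM.
by rewrite -(prim_order_dvd prim_wa) gtnNdvd // ltnS.
Qed.

Lemma norm_unity_sub1 (x : algC) :
  x ^+ n = 1 -> (x - 1) * (x ^+ n.-1 - 1) = `|x - 1| ^+ 2.
Proof.
move=> xn1; have x_norm : `|x| = 1.
  by apply/eqP; rewrite -(@pexpr_eq1 _ _ n) // -normrX xn1 normr1.
rewrite normCK rmorphB rmorph1; congr (_ * (_ - _)).
have x0 : x != 0 by rewrite -normr_eq0 x_norm oner_eq0.
apply: (mulfI x0); rewrite -exprS prednK // xn1 -normCK x_norm expr1n //.
Qed.

(** By the inequality 2 u v <= u^2 + v^2 in each conjugate, the norm of w^a - 1 is
    at least 2^(e / 2), whereas it is at most m^(e / (m - 1)) by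
    [cyc_norm_unity_pow]; here e is the number of conjugates. *)
Lemma conj_relation_order a b c m :
  w ^+ b != 1 -> w ^+ c != 1 -> m.-primitive_root (w ^+ a) ->
  (forall k, coprime k n ->
    `|(w ^+ k) ^+ b - 1| ^+ 2 + `|(w ^+ k) ^+ c - 1| ^+ 2
      = `|(w ^+ k) ^+ a - 1| ^+ 2) ->
  (m <= 6)%N.
Proof.
move=> wb wc prim_wa Ek.
have le1 : 2%:R ^+ e <= `|N a| ^+ 2.
  apply: le_trans (_ : 2%:R ^+ e * (`|N b| * `|N c|) <= _).
    by rewrite ler_peMr ?exprn_ge0 ?ler0n // mulr_ege1 ?cyc_norm_unity_ge1.
  rewrite -prodr_const !normr_prod -!big_split -prodrXl /=; apply: ler_prod => k co_k.
  rewrite !zhornerX1 -(Ek _ co_k).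
  rewrite !mulr_ge0 ?ler0n //=; set u := `|_|; set v := `|_|.
  have: 0 <= (u - v) ^+ 2 by rewrite real_exprn_even_ge0 // rpredB ?normr_real.
  by rewrite sqrrB addrAC subr_ge0 mulr_natl.
have e_gt0 : (0 < e)%N.
  by apply/card_gt0P; exists (Ordinal (ltn_pmod 1 n_gt0)); rewrite inE coprime_modl coprime1n.
rewrite leqNgt; apply/negP => /ltn_sqr_expn2; rewrite ltnNge => /negP[].
rewrite -(ler_nat algC) -(@ler_pXn2r _ e) ?nnegrE ?ler0n // !natrX.
rewrite ![_ ^+ _ ^+ e]exprAC.
apply: le_trans (_ : (`|N a| ^+ 2) ^+ m.-1 <= _).
  by apply: lerXn2r le1; rewrite nnegrE exprn_ge0 // ler0n.
rewrite exprAC lerXn2r ?nnegrE ?exprn_ge0 ?ler0n //.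
exact: cyc_norm_unity_pow.
Qed.
End ThreeRoots.

Lemma unity_exp_pred (F : fieldType) (n : nat) (x : F) :
  (0 < n)%N -> x ^+ n = 1 -> (x - 1) * (x ^+ n.-1 - 1) = 2 - x - x^-1.
Proof.
move=> n_gt0 xn1; have x0 : x != 0.
  by apply: contra_eq_neq xn1 => ->; rewrite expr0n gtn_eqF // eq_sym oner_eq0.
have -> : x ^+ n.-1 = x^-1 by apply: (mulfI x0); rewrite -exprS prednK // mulfV.
by field.
Qed.

(** The inverse of an n-th root of unity x is x^(n - 1), which makes the relation
    polynomial; and 2 - x - 1/x = |1 - x|^2 in the complex numbers.  The exponent
    60 is the least common multiple of 1, ..., 6. *)
Lemma unity_sum_order (F : fieldType) (f : {rmorphism rat -> F})
    (n : nat) (z t u s : F) :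
  n.-primitive_root z -> t ^+ n = 1 -> u ^+ n = 1 -> s ^+ n = 1 ->
  u != 1 -> s != 1 ->
  (2 - u - u^-1) + (2 - s - s^-1) = 2 - t - t^-1 -> t ^+ 60 = 1.
Proof.
move=> prim_z tn un sn u1 s1; have n_gt0 := prim_order_gt0 prim_z.
rewrite -!(unity_exp_pred n_gt0) // => E.
have [w prim_w] := C_prim_root_exists n_gt0.
have [a Da] := prim_rootP prim_z tn; have [b Db] := prim_rootP prim_z un.
have [c Dc] := prim_rootP prim_z sn.
pose Y i : {poly int} := ('X^i - 1) * ('X^(i * n.-1) - 1).
have YE (R : comNzRingType) (x : R) i :
    zhorner (Y i) x = (x ^+ i - 1) * ((x ^+ i) ^+ n.-1 - 1).
  by rewrite rmorphM hornerM !zhornerX1 exprM.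
have Pz : zhorner (Y b + Y c - Y a) z = 0.
  rewrite !(rmorphD, rmorphN) !(hornerD, hornerN) !YE -Da -Db -Dc E.
  exact: subrr.
have w1 i : z ^+ i != 1 -> w ^+ i != 1.
  by rewrite -(prim_order_dvd prim_z) -(prim_order_dvd prim_w).
have [m prim_wa _] : {m | m.-primitive_root (w ^+ a) & (m %| n)%N}.
  apply: prim_order_exists n_gt0 _.
  by rewrite -exprM mulnC exprM (prim_expr_order prim_w) expr1n.
have m_le6 : (m <= 6)%N.
  apply: (conj_relation_order prim_w _ _ prim_wa (b := b) (c := c)).
  - by rewrite w1 -?Db.
  - by rewrite w1 -?Dc.
  move=> k co_k; have prim_wk : n.-primitive_root (w ^+ k).
    by rewrite prim_root_exp_coprime.
  have := zhorner_transfer f prim_z prim_wk Pz.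
  rewrite !(rmorphD, rmorphN) !(hornerD, hornerN) !YE => /eqP.
  rewrite subr_eq0 => /eqP.
  have wk1 i : ((w ^+ k) ^+ i) ^+ n = 1.
    by rewrite -exprM mulnC exprM (prim_expr_order prim_wk) expr1n.
  by rewrite !(norm_unity_sub1 prim_w).
have m_dvd : (m %| 60)%N.
  have := prim_order_gt0 prim_wa.
  by move: m m_le6 {prim_wa} => [|[|[|[|[|[|[|m]]]]]]].
rewrite Da -exprM; apply/eqP; rewrite -(prim_order_dvd prim_z).
by rewrite (prim_order_dvd prim_w) exprM -(prim_order_dvd prim_wa).
Qed.

(** * Two by two matrices *)

Section Matrix2.
Context (K : comUnitRingType).
Implicit Types A B : 'M[K]_2.

Definition mx2 (a b c d : K) : 'M[K]_2 :=
  \matrix_(i, j) if i == 0 then if j == 0 then a else b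
                 else if j == 0 then c else d.

Lemma mx2E a b c d :
  (mx2 a b c d 0 0 = a) * (mx2 a b c d 0 1 = b) *
  (mx2 a b c d 1 0 = c) * (mx2 a b c d 1 1 = d).
Proof. by rewrite !mxE. Qed.

Lemma ord2P (P : 'I_2 -> Prop) : P 0 -> P 1 -> forall i, P i.
Proof.
move=> P0 P1 [[|[|//]] lt_i]; first by rewrite (_ : Ordinal _ = 0) //; apply: val_inj.
by rewrite (_ : Ordinal _ = 1) //; apply: val_inj.
Qed.

Lemma mx2P A B : A 0 0 = B 0 0 -> A 0 1 = B 0 1 -> A 1 0 = B 1 0 ->
  A 1 1 = B 1 1 -> A = B.
Proof. by move=> *; apply/matrixP; apply: ord2P; apply: ord2P. Qed.

Lemma mulmx2E m n (A : 'M[K]_(m, 2)) (B : 'M[K]_(2, n)) i j :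
  (A *m B) i j = A i 0 * B 0 j + A i 1 * B 1 j.
Proof.
rewrite mxE big_ord_recl big_ord1 (_ : lift _ _ = 1) //.
exact: val_inj.
Qed.

Lemma mul2E A B i j : (A * B) i j = A i 0 * B 0 j + A i 1 * B 1 j.
Proof. exact: mulmx2E. Qed.

Lemma det2 A : \det A = A 0 0 * A 1 1 - A 0 1 * A 1 0.
Proof.
rewrite (expand_det_row _ 0) big_ord_recl big_ord1 /cofactor.
rewrite !det_mx11 !mxE /= expr0 expr1 mul1r mulN1r mulrN.
have -> : lift 0 0 = 1 :> 'I_2 by apply: val_inj.
by have -> : lift 1 0 = 0 :> 'I_2 by apply: val_inj.
Qed.

Lemma tr2 A : \tr A = A 0 0 + A 1 1.
Proof. by rewrite /mxtrace big_ord_recl big_ord1 (_ : lift _ _ = 1) //; apply: val_inj. Qed.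

Lemma inv2 A : \det A = 1 -> A^-1 = mx2 (A 1 1) (- A 0 1) (- A 1 0) (A 0 0).
Proof.
move=> detA; have uA : A \is a GRing.unit by change (A \in unitmx); rewrite unitmxE detA unitr1.
apply: (mulrI uA); rewrite mulrV //; move: detA; rewrite det2 => detA.
by apply: mx2P; rewrite mul2E !mx2E !mxE /=; rewrite -?detA; ring.
Qed.

End Matrix2.

Lemma conj_expr (R : unitRingType) (x y : R) n :
  x \is a GRing.unit -> (x * y * x^-1) ^+ n = x * y ^+ n * x^-1.
Proof.
move=> ux; elim: n => [|n IHn]; first by rewrite !expr0 mulr1 mulrV.
by rewrite !exprS IHn !mulrA divrK.
Qed.

(** * Torsion groups of matrices with finite line stabilizers *)

Lemma unit_expr_eq1 (R : unitRingType) (S : set R) (x : R) :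
  x \is a GRing.unit -> finite_set S -> (forall n, S (x ^+ n)) ->
  exists2 n, (0 < n)%N & x ^+ n = 1.
Proof.
move=> ux finS Sx; apply: contrapT => ord_x; apply: infinite_nat.
have inj_x : injective (fun n => x ^+ n).
  suff lt_neq i j : (i < j)%N -> x ^+ i <> x ^+ j.
    by move=> i j Eij; case: (ltngtP i j) => // /lt_neq; rewrite Eij.
  move=> lt_ij Eij; apply: ord_x; exists (j - i)%N; first by rewrite subn_gt0.
  apply: (mulrI (unitrX i ux)); rewrite -exprD subnKC 1?ltnW // -Eij.
  by rewrite mulr1.
apply: sub_finite_set (finite_preimage (in2W inj_x) finS) => n _; exact: Sx.
Qed.

(** The lifts to SL2 of the groups of interest.  The last field bounds the
    stabilizers of points of the projective line in terms of vectors, which makes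
    the notion stable under conjugation in GL2 ([tame_conj]). *)
Record tame_group (K : fieldType) (H : set 'M[K]_2) : Prop := TameGroup {
  tame1 : H 1;
  tameM : forall A B, H A -> H B -> H (A * B);
  tameV : forall A, H A -> H A^-1;
  tame_det : forall A, H A -> \det A = 1;
  tame_stab : forall u : 'cV[K]_2, u != 0 ->
    finite_set [set A | H A /\ exists c : K, A *m u = c *: u] }.

Section TameGroups.
Context (K : fieldType) (ratK : {rmorphism rat -> K}).
Hypothesis sqrtK : forall x : K, exists y, y ^+ 2 = x.
Hypothesis primK : forall n, (0 < n)%N -> exists z : K, n.-primitive_root z.
Implicit Types (A B P g h : 'M[K]_2) (H : set 'M[K]_2).

Lemma natK n : (n%:R == 0 :> K) = (n == 0)%N.
Proof. by rewrite -(rmorph_nat ratK) fmorph_eq0 pnatr_eq0. Qed.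

(** The eigenvalue l is a root of x^2 - (tr A) x + 1, hence the trace formula. *)
Lemma eigenvector2 A : \det A = 1 ->
  exists (u : 'cV[K]_2) (l : K), [/\ u != 0, A *m u = l *: u & \tr A = l + l^-1].
Proof.
move=> detA; have [y Dy] := sqrtK (\tr A ^+ 2 - 4).
pose l := (\tr A + y) / 2; have two0 : 2 != 0 :> K by rewrite natK.
have l2 : l ^+ 2 = \tr A * l - 1.
  have : l * 2 = \tr A + y by rewrite divfK.
  move=> l2; apply: (mulfI two0); apply: (mulfI two0).
  have -> : 2 * (2 * l ^+ 2) = (l * 2) ^+ 2 by ring.
  have -> : 2 * (2 * (\tr A * l - 1)) = 2 * \tr A * (l * 2) - 4 by ring.
  rewrite l2 sqrrD Dy; ring.
have l0 : l != 0.
  by apply: contra_eq_neq l2 => ->; rewrite expr0n mulr0 sub0r eq_sym oppr_eq0 oner_eq0.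
have trl : \tr A = l + l^-1.
  by apply: (mulIf l0); rewrite mulrDl mulVf // -expr2 l2 subrK.
have: \det (A - l%:M)^T == 0.
  move: detA l2; rewrite det_tr tr2 !det2 !mxE /= !mulr1n !mulr0n => detA.
  rewrite !subr0 => l2; rewrite -(subrr (l ^+ 2)) [in X in _ == _ - X]l2 -detA.
  by apply/eqP; ring.
case/det0P => v v0 /(congr1 trmx); rewrite trmx_mul trmxK trmx0 mulmxBl.
rewrite mul_scalar_mx => /eqP; rewrite subr_eq0 => /eqP Av.
by exists v^T, l; split=> //; rewrite -trmx0 (inj_eq trmx_inj).
Qed.

Section OneGroup.
Context (H : set 'M[K]_2).
Hypothesis tameH : tame_group H.

Lemma tameX A n : H A -> H (A ^+ n).
Proof.
move=> HA; elim: n => [|n IHn]; first by rewrite expr0; apply: tame1.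
by rewrite exprS; apply: tameM.
Qed.

Lemma mulmx_pow_eigen A (u : 'cV[K]_2) l n :
  A *m u = l *: u -> A ^+ n *m u = l ^+ n *: u.
Proof.
move=> Au; elim: n => [|n IHn]; first by rewrite !expr0 mul1mx scale1r.
by rewrite exprSr -[A ^+ n * A]/(A ^+ n *m A) -mulmxA Au -scalemxAr IHn scalerA -exprS.
Qed.

Lemma tame_unit A : H A -> A \is a GRing.unit.
Proof.
move=> HA; change (A \in unitmx); rewrite unitmxE.
by rewrite (tame_det tameH HA) unitr1.
Qed.

(** The powers of A all fix the line of an eigenvector of A, so they range over a
    finite set.  The eigenvalue l satisfies every equation l^k = 1 that A does,
    which keeps track of the exponent of the group. *)
Lemma tame_torsion A : H A ->
  exists (n : nat) (l : K), [/\ (0 < n)%N, A ^+ n = 1,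
    forall k, A ^+ k = 1 -> l ^+ k = 1 & \tr A = l + l^-1].
Proof.
move=> HA; have [u [l [u0 Au trA]]] := eigenvector2 (tame_det tameH HA).
have uA := tame_unit HA.
have [n n_gt0 An1] : exists2 n, (0 < n)%N & A ^+ n = 1.
  apply: unit_expr_eq1 (tame_stab tameH u0) _ => // n; split; first exact: tameX.
  by exists (l ^+ n); apply: mulmx_pow_eigen.
exists n, l; split=> // k Ak1; have := mulmx_pow_eigen k Au.
rewrite Ak1 mul1mx => /eqP; rewrite -{1}[u]scale1r -subr_eq0 -scalerBl.
by rewrite scaler_eq0 (negPf u0) orbF subr_eq0 eq_sym => /eqP.
Qed.

(** The stabilizers of the two coordinate lines. *)
Lemma tame_fix0 : finite_set [set A | H A /\ A 1 0 = 0].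
Proof.
pose u : 'cV[K]_2 := delta_mx 0 0.
have u0 : u != 0 by apply/eqP => /matrixP/(_ 0 0)/eqP; rewrite !mxE oner_eq0.
apply: sub_finite_set (tame_stab tameH u0) => A [HA A10]; split=> //.
exists (A 0 0); rewrite -colE; apply/matrixP => i j; move: i; apply: ord2P.
  by rewrite !mxE (ord1 j) mulr1.
by rewrite !mxE A10 mulr0.
Qed.

Lemma tame_fix1 : finite_set [set A | H A /\ A 0 1 = 0].
Proof.
pose u : 'cV[K]_2 := delta_mx 1 0.
have u0 : u != 0 by apply/eqP => /matrixP/(_ 1 0)/eqP; rewrite !mxE oner_eq0.
apply: sub_finite_set (tame_stab tameH u0) => A [HA A01]; split=> //.
exists (A 1 1); rewrite -colE; apply/matrixP => i j; move: i; apply: ord2P.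
  by rewrite !mxE A01 mulr0.
by rewrite !mxE (ord1 j) mulr1.
Qed.

(** As g has finite order n, its minimal polynomial divides X^n - 1, which has
    simple roots. *)
Lemma tame_diagonalize g : H g -> g != 1 -> g != -1 ->
  exists (P : 'M[K]_2) (l : K),
    [/\ P \is a GRing.unit, l != 0, l ^+ 2 != 1 & g = P * mx2 l 0 0 l^-1 * P^-1].
Proof.
move=> Hg g1 gN1; have [n [_ [n_gt0 gn1 _ _]]] := tame_torsion Hg.
have [z prim_z] := primK n_gt0.
have : diagonalizable g.
  apply/diagonalizableP; exists [seq z ^+ i | i <- index_iota 0 n].
    rewrite map_inj_in_uniq ?iota_uniq // => i j.
    rewrite !mem_index_iota /= => lt_i lt_j /eqP.
    by rewrite (eq_prim_root_expr prim_z) !modn_small // => /eqP.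
  rewrite big_map (factor_Xn_sub_1 prim_z); apply: mxminpoly_min.
  by rewrite rmorphB rmorph1 rmorphXn /= horner_mx_X gn1 subrr.
case=> Q uQ /(diagonalizable_forLR uQ)[D]; rewrite mxpoly.conjVmx // => Dg.
have uQ' : Q \is a GRing.unit by [].
have {}Dg : g = Q^-1 * diag_mx D * Q by [].
have DD : diag_mx D = mx2 (D 0 0) 0 0 (D 0 1).
  by apply: mx2P; rewrite mx2E !mxE ?mulr1n ?mulr0n.
have detD : D 0 0 * D 0 1 = 1.
  rewrite -(tame_det tameH Hg) Dg !det_mulmx mulrAC det_inv.
  by rewrite mulVr ?mul1r -?unitmxE // DD det2 !mx2E mul0r subr0.
have D0 : D 0 0 != 0.
  by apply: contra_eq_neq detD => ->; rewrite mul0r eq_sym oner_eq0.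
have D1 : D 0 1 = (D 0 0)^-1 by apply: (mulfI D0); rewrite detD mulfV.
exists Q^-1, (D 0 0); split; rewrite ?unitrV ?invrK //; last by rewrite Dg DD D1.
rewrite sqrf_eq1 negb_or; apply/andP; split.
  apply: contraNneq g1 => l1; rewrite Dg DD D1 l1 invr1.
  rewrite (_ : mx2 1 0 0 1 = 1) ?mulr1 ?mulVr //.
  by apply: mx2P; rewrite mx2E !mxE.
apply: contraNneq gN1 => l1; rewrite Dg DD D1 l1 invrN invr1.
rewrite (_ : mx2 (-1) 0 0 (-1) = -1) ?mulrN1 ?mulNr ?mulVr //.
by apply: mx2P; rewrite mx2E !mxE /= ?oppr0.
Qed.

Lemma tame_conj P : P \is a GRing.unit ->
  tame_group [set A | H (P * A * P^-1)].
Proof.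
move=> uP; have uP' : P \in unitmx by [].
split=> /=.
- by rewrite mulr1 mulrV //; apply: tame1.
- move=> A B HA HB; have := tameM tameH HA HB.
  by rewrite !mulrA divrK.
- move=> A HA; have uA : A \is a GRing.unit.
    have : P *m A *m invmx P \in unitmx by apply: tame_unit HA.
    by rewrite !unitmx_mul => /andP[/andP[]].
  by have := tameV tameH HA; rewrite !invrM ?invrK ?mulrA ?unitrMr ?unitrV.
- move=> A /(tame_det tameH); rewrite !det_mulmx mulrAC det_inv.
  by rewrite mulrV ?mul1r // -unitmxE.
move=> u u0; have Pu0 : P *m u != 0.
  by apply: contraNneq u0 => Pu0; rewrite -(mulKmx uP' u) Pu0 mulmx0.
have inj_P : injective (fun A => P * A * P^-1).
  have uV : P^-1 \is a GRing.unit by rewrite unitrV.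
  by move=> A B /(mulIr uV)/(mulrI uP).
apply: sub_finite_set (finite_preimage (in2W inj_P) (tame_stab tameH Pu0)).
move=> A [HA [c Au]]; split=> //; exists c.
rewrite -[P * A * P^-1]/(P *m A *m invmx P) -!mulmxA (mulmxA (invmx P)) mulVmx //.
by rewrite mul1mx Au scalemxAr.
Qed.

Lemma mx2_diagX (a b : K) n : mx2 a 0 0 b ^+ n = mx2 (a ^+ n) 0 0 (b ^+ n).
Proof.
elim: n => [|n IHn]; first by apply: mx2P; rewrite mx2E !mxE.
by apply: mx2P; rewrite exprS IHn mul2E !mx2E ?exprS; ring.
Qed.

Lemma subV_neq0 (l : K) : l != 0 -> l ^+ 2 != 1 -> l - l^-1 != 0.
Proof.
move=> l0; apply: contraNneq => /subr0_eq lV.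
by rewrite expr2 [X in _ * X]lV mulfV.
Qed.

(** The matrices 1, g, h, g h, with g = diag(l, 1/l), form a basis of the matrix
    algebra as soon as h has nonzero off-diagonal entries; the trace form being
    nondegenerate, an element is determined by four traces, each a sum of a root
    of unity of order dividing M and its inverse. *)
Lemma tame_finite_bounded M l h :
  (0 < M)%N -> (forall A, H A -> A ^+ M = 1) ->
  l != 0 -> l ^+ 2 != 1 -> h 0 1 != 0 -> h 1 0 != 0 ->
  H (mx2 l 0 0 l^-1) -> H h -> finite_set H.
Proof.
move=> M_gt0 HM l0 l2 h01 h10 Hg Hh; set g := mx2 l 0 0 l^-1 in Hg.
have [z prim_z] := primK M_gt0.
pose T : set K := [set z ^+ i + z ^- i | i in `I_M].
have finT : finite_set T by apply/finite_image/finite_II.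
have trT A : H A -> T (\tr A).
  move=> HA; have [n [e [_ _ eM ->]]] := tame_torsion HA.
  have [i ->] := prim_rootP prim_z (eM _ (HM _ HA)).
  by exists i => //=.
pose F A := (\tr A, \tr (A * g), (\tr (A * h), \tr (A * (g * h)))).
have injF : injective F.
  move=> A B [].
  rewrite !tr2 !mul2E !mx2E.
  have lV := subV_neq0 l0 l2 => E1 E2 E3 E4.
  have E00 : A 0 0 = B 0 0.
    apply: (mulfI lV).
    have -> (C : 'M_2) : (l - l^-1) * C 0 0 = C 0 0 * l + C 0 1 * 0
        + (C 1 0 * 0 + C 1 1 / l) - (C 0 0 + C 1 1) / l by ring.
    by rewrite E1 E2; ring.
  have E11 : A 1 1 = B 1 1 by apply: (addrI (A 0 0)); rewrite E1 E00.
  rewrite E00 E11 in E3 E4.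
  (* Eliminate the (0, 1) entry between the last two traces. *)
  have E10 : A 1 0 = B 1 0.
    apply: (mulfI (mulf_neq0 lV h01)).
    have D x y : (l - l^-1) * h 0 1 * y =
        B 0 0 * (l * h 0 0 + 0 * h 1 0) + x * (0 * h 0 0 + l^-1 * h 1 0)
        + (y * (l * h 0 1 + 0 * h 1 1) + B 1 1 * (0 * h 0 1 + l^-1 * h 1 1))
        - (B 0 0 * h 0 0 + x * h 1 0 + (y * h 0 1 + B 1 1 * h 1 1)) / l
        - B 0 0 * h 0 0 * (l - l^-1) by ring.
    by rewrite (D (A 0 1)) E4 E3; ring.
  have E01 : A 0 1 = B 0 1.
    apply: (mulIf h10); move: E3; rewrite E10 => /addIr/addrI //.
  exact: mx2P.
apply: sub_finite_set (finite_preimage (in2W injF)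
  (finite_setX (finite_setX finT finT) (finite_setX finT finT))).
by move=> A HA; do 2!split => /=; apply: trT; do ?apply: (tameM tameH).
Qed.

(** Applying the dichotomy to h h and h g h, too, shows that an element h moving
    both coordinate lines exchanges them.  So the group is covered by the two
    stabilizers of these lines and the set of elements exchanging them, which is
    empty or a translate of a subset of a stabilizer. *)
Lemma tame_finite_split l :
  l != 0 -> l ^+ 2 != 1 -> H (mx2 l 0 0 l^-1) ->
  (forall h, H h -> h 0 1 * h 1 0 = 0 \/ h 0 0 * h 1 1 = 0) -> finite_set H.
Proof.
move=> l0 l2 Hg Hsplit.
have Hanti h : H h -> h 0 1 * h 1 0 != 0 -> h 0 0 = 0 /\ h 1 1 = 0.
  move=> Hh bc0; have ad0 : h 0 0 * h 1 1 = 0.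
    by case: (Hsplit h Hh) => // bc; rewrite bc eqxx in bc0.
  have := tame_det tameH Hh; rewrite det2 ad0 sub0r => /eqP.
  rewrite eqr_oppLR => /eqP bc.
  have := Hsplit _ (tameM tameH Hh Hh).
  have := Hsplit _ (tameM tameH (tameM tameH Hh Hg) Hh).
  rewrite !mul2E !mx2E; move: bc ad0 bc0.
  move: (h 0 0) (h 0 1) (h 1 0) (h 1 1) => a b c d bc /eqP.
  rewrite !mulf_eq0 negb_or => /orP[]/eqP -> /andP[b0 c0].
    (* a = 0 and d <> 0: the two vanishing products force d^2 = l^2 and d^2 = 1. *)
    rewrite ?(mulr0, mul0r, add0r, addr0); have [-> //|d0] := eqVneq d 0.
    case=> /eqP; rewrite !mulf_eq0 ?invr_eq0 ?(negPf b0) ?(negPf c0) ?(negPf d0)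
      ?(negPf l0) //= => /eqP P1.
    case=> /eqP; rewrite !mulf_eq0 ?(negPf b0) ?(negPf c0) ?(negPf d0) //= => /eqP P2.
    have : (c * b) * (l ^+ 2 - 1) = 0.
      have -> : (c * b) * (l ^+ 2 - 1) = l * (c * l * b + d / l * d) - (c * b + d * d).
        by field.
      by rewrite P1 P2 mulr0 subr0.
    by move/eqP; rewrite !mulf_eq0 (negPf b0) (negPf c0) subr_eq0 (negPf l2).
  (* d = 0 and a <> 0 is symmetric. *)
  rewrite ?(mulr0, mul0r, add0r, addr0); have [-> //|a0] := eqVneq a 0.
  case=> /eqP; rewrite !mulf_eq0 ?invr_eq0 ?(negPf b0) ?(negPf c0) ?(negPf a0)
    ?(negPf l0) ?orbF //= => /eqP P1.
  case=> /eqP; rewrite !mulf_eq0 ?(negPf b0) ?(negPf c0) ?(negPf a0) ?orbF //= => /eqP P2.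
  have : (a * a) * (l ^+ 2 - 1) = 0.
    have -> : (a * a) * (l ^+ 2 - 1) = l * (a * l * a + b / l * c) - (a * a + b * c).
      by field.
    by rewrite P1 P2 mulr0 subr0.
  by move/eqP; rewrite !mulf_eq0 (negPf a0) subr_eq0 (negPf l2).
pose W := [set h | H h /\ (h 0 0 = 0 /\ h 1 1 = 0)].
have finW : finite_set W.
  have [[s [Hs [s00 s11]]]|noW] := pselect (exists s, W s); last first.
    by rewrite (_ : W = set0) // -subset0 => s Ws; apply: noW; exists s.
  have inj_s : injective (fun A => s * A) := mulrI (tame_unit Hs).
  apply: sub_finite_set (finite_preimage (in2W inj_s) tame_fix0).
  move=> A [HA [A00 A11]]; split; first exact: tameM.
  by rewrite mul2E s11 A00 mulr0 mul0r addr0.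
have cover : H `<=` [set A | H A /\ A 1 0 = 0] `|` [set A | H A /\ A 0 1 = 0] `|` W.
  move=> h Hh; case: (eqVneq (h 0 1 * h 1 0) 0) => [/eqP|/(Hanti _ Hh)]; last by right.
  by rewrite mulf_eq0 => /orP[/eqP|/eqP] ?; left; [right|left].
apply: sub_finite_set cover _; rewrite !finite_setU; do ?split=> //.
  exact: tame_fix0.
exact: tame_fix1.
Qed.

(** The traces of the commutator of g and h and of g h g h^-1, where
    g = diag(l, 1/l), give the relation of [unity_sum_order] with t = l^2.  The
    two hypotheses on the entries of h say that the roots u and s are not 1. *)
Lemma tame_order l h :
  l != 0 -> l ^+ 2 != 1 -> h 0 1 * h 1 0 != 0 -> h 0 0 * h 1 1 != 0 ->
  H (mx2 l 0 0 l^-1) -> H h -> l ^+ 120 = 1.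
Proof.
move=> l0 l2 bc ad; set g := mx2 _ _ _ _ => Hg Hh.
have deth := tame_det tameH Hh; have detg := tame_det tameH Hg.
have Hg' := tameV tameH Hg; have Hh' := tameV tameH Hh.
have [n1 [_ [n1_gt0 gn1 _ _]]] := tame_torsion Hg.
have [n2 [u [n2_gt0 un2 /(_ _ un2) {}un2 tru]]] :=
  tame_torsion (tameM tameH (tameM tameH Hg Hh) (tameM tameH Hg' Hh')).
have [n3 [s [n3_gt0 sn3 /(_ _ sn3) {}sn3 trs]]] :=
  tame_torsion (tameM tameH (tameM tameH Hg Hh) (tameM tameH Hg Hh')).
have ln1 : l ^+ n1 = 1.
  by have := congr1 (fun A : 'M_2 => A 0 0) gn1; rewrite mx2_diagX mx2E mxE.
have N_gt0 : (0 < n1 * (n2 * n3))%N by rewrite !muln_gt0 n1_gt0 n2_gt0.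
have [z prim_z] := primK N_gt0.
pose q := (l - l^-1) ^+ 2.
have q0 : q != 0 by rewrite expf_neq0 ?subV_neq0.
have two_det : 2 = 2 * (h 0 0 * h 1 1 - h 0 1 * h 1 0) :> K.
  by rewrite -det2 deth mulr1.
have Eu : 2 - u - u^-1 = h 0 1 * h 1 0 * q.
  rewrite -addrA -opprD -tru tr2 !mul2E !inv2 // !mx2E.
  by rewrite two_det /q; field.
have Es : 2 - s - s^-1 = - (h 0 0 * h 1 1) * q.
  rewrite -addrA -opprD -trs tr2 !mul2E !inv2 // !mx2E.
  by rewrite two_det /q; field.
rewrite (exprM l 2 60); apply: (unity_sum_order ratK prim_z (u := u) (s := s)).
- by rewrite exprAC exprM ln1 !expr1n.
- by rewrite mulnCA exprM un2 expr1n.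
- by rewrite mulnA mulnC exprM sn3 expr1n.
- apply: contraNneq (mulf_neq0 bc q0) => u1; rewrite -Eu u1 invr1; apply/eqP; ring.
- apply: contraNneq (mulf_neq0 ad q0) => s1.
  by rewrite -[_ * q]opprK -mulNr -Es s1 invr1 oppr_eq0; apply/eqP; ring.
rewrite Eu Es -mulrDl; move: deth; rewrite det2 => deth.
have -> : h 0 1 * h 1 0 - h 0 0 * h 1 1 = -1 by rewrite -deth; ring.
by rewrite /q; field.
Qed.

End OneGroup.

(** In the second case each element other than 1 and -1 comes with some h that
    satisfies the hypotheses of [tame_order], whence the exponent 120 for the
    whole group; one pair g, h then suffices for [tame_finite_bounded]. *)
Lemma tame_finite H : tame_group H -> finite_set H.
Proof.
move=> tameH.
have [[g [Hg [g1 gN1]]]|scalarH] := pselect (exists g, H g /\ (g != 1 /\ g != -1)); last first.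
  apply: (@sub_finite_set _ _ ([set 1] `|` [set -1])) => [g Hg|].
    apply: contrapT => gN; apply: scalarH; exists g; split=> //.
    by split; apply/eqP => g1; apply: gN; [left|right].
  by rewrite finite_setU; split; apply: finite_set1.
have finite_conj P : P \is a GRing.unit ->
    finite_set [set A | H (P * A * P^-1)] -> finite_set H.
  move=> uP finP.
  apply: sub_finite_set (finite_image (fun A => P * A * P^-1) finP) => A HA /=.
  have PAP : P * (P^-1 * A * P) * P^-1 = A by rewrite !mulrA divrr // mul1r mulrK.
  by exists (P^-1 * A * P); rewrite /= PAP.
have [[P [l [uP l0 l2 [HPl splitP]]]]|nonsplit] := pselect (exists P l,
    [/\ P \is a GRing.unit, l != 0, l ^+ 2 != 1 & H (P * mx2 l 0 0 l^-1 * P^-1) /\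
     forall h, H (P * h * P^-1) -> h 0 1 * h 1 0 = 0 \/ h 0 0 * h 1 1 = 0]).
  apply: (finite_conj P uP).
  exact: (tame_finite_split (tame_conj tameH uP) l0 l2 HPl).
have find_h P l : P \is a GRing.unit -> l != 0 -> l ^+ 2 != 1 ->
    H (P * mx2 l 0 0 l^-1 * P^-1) ->
    exists h, [/\ H (P * h * P^-1), h 0 1 * h 1 0 != 0 & h 0 0 * h 1 1 != 0].
  move=> uP l0 l2 Hg'; apply: contrapT => no_h; apply: nonsplit.
  exists P, l; split=> //; split=> // h Hh.
  have [->|bc] := eqVneq (h 0 1 * h 1 0) 0; first by left.
  have [->|ad] := eqVneq (h 0 0 * h 1 1) 0; first by right.
  by case: no_h; exists h.
have H120 A : H A -> A ^+ 120 = 1.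
  move=> HA; have [->|A1] := eqVneq A 1; first by rewrite expr1n.
  have [->|AN1] := eqVneq A (-1); first by rewrite -signr_odd expr0.
  have [P [l [uP l0 l2 DA]]] := tame_diagonalize tameH HA A1 AN1.
  have HPl := HA; rewrite DA in HPl; have [h [Hh bc ad]] := find_h P l uP l0 l2 HPl.
  have l120 := tame_order (tame_conj tameH uP) l0 l2 bc ad HPl Hh.
  rewrite DA conj_expr // mx2_diagX exprVn l120 invr1.
  by rewrite (_ : mx2 1 0 0 1 = 1) ?mulr1 ?mulrV //; apply: mx2P; rewrite mx2E !mxE.
have [P [l [uP l0 l2 Dg]]] := tame_diagonalize tameH Hg g1 gN1.
rewrite Dg in Hg; have [h [Hh]] := find_h P l uP l0 l2 Hg.
rewrite mulf_eq0 negb_or => /andP[h01 h10] _; apply: (finite_conj P uP).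
apply: (tame_finite_bounded (tame_conj tameH uP) (M := 120) _ _ l0 l2 h01 h10 Hg Hh) => //.
move=> A /H120; have uV : P^-1 \is a GRing.unit by rewrite unitrV.
rewrite conj_expr // -[RHS](mulrV uP) -[X in _ = X * _]mulr1 => /(mulIr uV)/(mulrI uP) //.
Qed.
End TameGroups.

(** * Roots of unity and square roots in Cp *)

Lemma prim_root_closed (L : closedFieldType) (ratL : {rmorphism rat -> L}) n :
  (0 < n)%N -> exists z : L, n.-primitive_root z.
Proof.
move=> n_gt0; pose q : {poly L} := 'X^n - 1.
have [r Dq] := closed_field_poly_normal q.
rewrite (monicP _) ?monicXnsubC // scale1r in Dq.
have rn1 : all n.-unity_root r by apply/allP=> z; rewrite -root_prod_XsubC -Dq.
have sz_r : (n < (size r).+1)%N by rewrite -(size_prod_XsubC r id) -Dq size_XnsubC.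
have [|z] := hasP (has_prim_root n_gt0 rn1 _ sz_r); last by exists z.
rewrite -separable_prod_XsubC -Dq separable_Xn_sub_1 //.
by rewrite -(rmorph_nat ratL) fmorph_eq0 pnatr_eq0 -lt0n.
Qed.

Section Ultrametric.
Context (R : realType) (K : fieldType) (v : nonarch_abs R K).

Lemma abs_gt0 x : x != 0 -> 0 < v x.
Proof. by move=> x0; rewrite lt_def abs_eq0 x0 abs_ge0. Qed.

Lemma absB x y : v (x - y) <= Num.max (v x) (v y).
Proof. by rewrite -(absN v y) absD. Qed.

Lemma absBC x y : v (x - y) = v (y - x).
Proof. by rewrite -absN opprB. Qed.

Lemma absV x : v x^-1 = (v x)^-1.
Proof.
have [->|x0] := eqVneq x 0; first by rewrite invr0 abs0 invr0.
have vx0 : v x != 0 by rewrite abs_eq0.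
by apply: (mulfI vx0); rewrite -absM !mulfV // abs1.
Qed.

Lemma abs_nat_le1 n : v n%:R <= 1.
Proof.
elim: n => [|n IHn]; first by rewrite abs0 ler01.
by rewrite -natr1 (le_trans (absD _ _ _)) // ge_max IHn abs1 lexx.
Qed.

Lemma absD_eq x y : v y < v x -> v (x + y) = v x.
Proof.
move=> lt_yx; apply/eqP; rewrite eq_le; apply/andP; split.
  by rewrite (le_trans (absD _ _ _)) // ge_max lexx ltW.
have : v x <= Num.max (v (x + y)) (v y) by rewrite -{1}(addrK y x) absB.
by rewrite le_max (leNgt _ (v y)) lt_yx orbF.
Qed.

(** Fix y0 in L so close to x that a square root s0 of it satisfies
    |s0^2 - x| < |2 s0|^2 = M^2.  An element y of L nearby has a unique square
    root t with |t - s0| < M; for two such roots |t + t'| = M, so that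
    |t - t'| = |y - y'| / M: these roots depend continuously on y, and the roots
    of a sequence tending to x form a Cauchy sequence. *)
Lemma completion_sqrt (L : closedFieldType) (k : {rmorphism L -> K}) :
  2 != 0 :> K -> dense_image v k -> complete_abs v ->
  forall x : K, exists y, y ^+ 2 = x.
Proof.
move=> two0 dense_k complete x.
have [->|x0] := eqVneq x 0; first by exists 0; rewrite expr0n.
have sqrtL (y : L) : exists t, t ^+ 2 = y.
  have [t] := solve_monicpoly (fun i => if i == 0 then y else 0) (isT : (0 < 2)%N).
  by rewrite big_ord_recl big_ord1 /= mul0r addr0 mulr1 => ?; exists t.
have eps0 : 0 < v 4 * v x.
  by rewrite mulr_gt0 ?abs_gt0 // (_ : 4 = 2 * 2 :> K) ?mulf_neq0 // -natrM.
have [y0 xy0] := dense_k x _ eps0; have [s0 Ds0] := sqrtL y0.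
pose M := v (2 * k s0).
have vy0 : v (k y0) = v x.
  rewrite -[k y0](subrK x) addrC absD_eq // absBC (lt_le_trans xy0) //.
  by rewrite ler_piMl ?abs_ge0 // abs_nat_le1.
have M2 : M ^+ 2 = v 4 * v x.
  rewrite /M expr2 -absM -vy0 -absM -Ds0 rmorphXn; congr (v _).
  by rewrite /=; ring.
have M_gt0 : 0 < M.
  rewrite lt_def abs_ge0 andbT; apply: contraTneq eps0; rewrite -/M => M0.
  by rewrite -M2 M0 expr0n ltxx.
pose e n : R := Num.min (M ^+ 2) (M / n.+1%:R).
have e_gt0 n : 0 < e n.
  by rewrite lt_min exprn_gt0 //= divr_gt0 // ltr0n.
have near n : {t : L | v (x - k (t ^+ 2)) < e n /\ v (k t - k s0) < M}.
  apply: cid; have [y xy] := dense_k x _ (e_gt0 n); have [t Dt] := sqrtL y.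
  have prodM : v (k t - k s0) * v (k t + k s0) < M * M.
    rewrite -absM -subr_sqr -!rmorphXn Dt Ds0 /=.
    rewrite (_ : _ - _ = (x - k y0) - (x - k y)); last by ring.
    rewrite (le_lt_trans (absB _ _)) // gt_max -expr2 M2 xy0 -M2.
    by rewrite (lt_le_trans xy) // ge_min lexx.
  have [tm|tm] := ltP (v (k t - k s0)) M; first by exists t; rewrite Dt.
  exists (- t); rewrite sqrrN Dt; split=> //.
  rewrite rmorphN -opprD absN ltNge; apply/negP => tp.
  by move: prodM; rewrite ltNge ler_pM // ltW.
pose t n := k (projT1 (near n)).
have xt n : v (x - t n ^+ 2) < e n.
  by rewrite /t -rmorphXn; case: (projT2 (near n)).
have ts0 n : v (t n - k s0) < M by case: (projT2 (near n)).
have tt m n : v (t m - t n) * M < Num.max (e m) (e n).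
  have -> : M = v (t m + t n).
    rewrite (_ : t m + t n = 2 * k s0 + ((t m - k s0) + (t n - k s0))); last by ring.
    by rewrite absD_eq // (le_lt_trans (absD _ _ _)) // gt_max !ts0.
  rewrite -absM -subr_sqr (_ : _ - _ = (x - t n ^+ 2) - (x - t m ^+ 2)); last by ring.
  by rewrite (le_lt_trans (absB _ _)) // gt_max !lt_max !xt orbT.
have e_le N n : (N <= n)%N -> e n <= M / N.+1%:R.
  move=> leNn; rewrite ge_min; apply/orP; right.
  by rewrite ler_pM2l // lef_pV2 ?posrE ?ltr0n // ler_nat.
have small (d : R) : 0 < d -> exists N : nat, N.+1%:R^-1 < d.
  move=> d0; exists (Num.truncn d^-1).
  by rewrite invf_plt ?posrE ?ltr0n // truncnS_gt.
have [|l tl] := complete t.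
  move=> d d0; have [N dN] := small d d0; exists N => m n leNm leNn.
  rewrite -(ltr_pM2r M_gt0) (lt_le_trans (tt m n)) // ge_max.
  have dM : M / N.+1%:R <= d * M by rewrite mulrC ler_pM2r // ltW.
  by rewrite !(le_trans (e_le N _ _)).
(* If d = |l^2 - x| were positive, some t_n close to l would have both
   |l^2 - t_n^2| and |x - t_n^2| less than d. *)
exists l; apply/eqP; rewrite -subr_eq0 -(abs_eq0 v) -[_ == 0]negbK.
apply/negP => d0; have {}d0 : 0 < v (l ^+ 2 - x) by rewrite lt_def d0 abs_ge0.
set d := v _ in d0.
have c0 : 0 < 1 + v (2 * l) by rewrite ltr_pwDl ?ltr01 // abs_ge0.
pose r := Num.min 1 (d / (1 + v (2 * l))).
have r0 : 0 < r by rewrite lt_min ltr01 divr_gt0.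
have [N1 _ tlN] := (cvg_ballP _ _).1 tl r r0.
have [N2 dN2] := small (d / M) (divr_gt0 d0 M_gt0).
pose n := maxn N1 N2; have {tlN} := tlN n (leq_maxl _ _).
rewrite /ball /= sub0r normrN ger0_norm ?abs_ge0 // lt_min => /andP[tl1 tlr].
have xtd : v (x - t n ^+ 2) < d.
  rewrite (lt_le_trans (xt n)) // (le_trans (e_le N2 _ _)) ?leq_maxr //.
  by rewrite mulrC -ler_pdivlMr // ltW.
have ltd : v (l ^+ 2 - t n ^+ 2) < d.
  rewrite subr_sqr absM absBC.
  have : v (l + t n) <= 1 + v (2 * l).
    rewrite (_ : l + t n = 2 * l + (t n - l)); last by ring.
    rewrite (le_trans (absD _ _ _)) // ge_max.
    by rewrite lerDr ler01 /= (le_trans (ltW tl1)) // lerDl abs_ge0.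
  move=> le; apply: le_lt_trans (_ : v (t n - l) * (1 + v (2 * l)) < _).
    by rewrite ler_wpM2l ?abs_ge0.
  by rewrite -ltr_pdivlMr.
have : d < d.
  rewrite {1}/d (_ : l ^+ 2 - x = (l ^+ 2 - t n ^+ 2) - (x - t n ^+ 2)); last by ring.
  by rewrite (le_lt_trans (absB _ _)) // gt_max ltd xtd.
by rewrite ltxx.
Qed.

End Ultrametric.

Lemma Cp_closure (R : realType) (p : nat) (Cp : fieldType) (v : nonarch_abs R Cp) :
  is_Cp p v ->
  exists ratCp : {rmorphism rat -> Cp},
    (forall x : Cp, exists y, y ^+ 2 = x) /\
    (forall n, (0 < n)%N -> exists z : Cp, n.-primitive_root z).
Proof.
case=> Qp [vQp [i [Qpbar [vQpbar [j [k [_ _ _ [_ dense_k complete]]]]]]]].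
pose ratL : {rmorphism rat -> Qpbar} := j \o i.
pose ratCp : {rmorphism rat -> Cp} := k \o ratL.
exists ratCp; split.
  apply: (completion_sqrt _ dense_k complete).
  by rewrite -(rmorph_nat ratCp) fmorph_eq0 pnatr_eq0.
move=> n /(prim_root_closed ratL)[z prim_z]; exists (k z).
by rewrite fmorph_primitive_root.
Qed.

(** * Invariant lattices of finite groups *)

Lemma finite_argmax (R : realType) (T : eqType) (S : set T) (f : T -> R) :
  finite_set S -> S !=set0 -> exists2 x, S x & forall y, S y -> f y <= f x.
Proof.
move=> /finite_seqP[s ->] [x0 /= x0s].
elim: s x0 x0s => // a s IHs x0 _.
case: s IHs => [_|b s /(_ b (mem_head _ _))[m ms max_m]].
  by exists a; rewrite /= ?mem_head // => y; rewrite /= inE => /eqP->.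
have [le_am|/ltW le_ma] := leP (f a) (f m).
  exists m => [|y]; rewrite /= in_cons; first by rewrite ms orbT.
  by case/orP=> [/eqP->|/max_m].
exists a => [|y]; rewrite /= in_cons ?eqxx //.
by case/orP=> [/eqP->//|/max_m /le_trans]; apply.
Qed.

Section Lattice.
Context (R : realType) (K : fieldType) (v : nonarch_abs R K).

Lemma abs_div_le1 x y : y != 0 -> v x <= v y -> v (x / y) <= 1.
Proof. by move=> y0 xy; rewrite absM absV ler_pdivrMr ?mul1r ?abs_gt0. Qed.

Lemma absM_le1 x y : v x <= 1 -> v y <= 1 -> v (x * y) <= 1.
Proof. by move=> x1 y1; rewrite absM mulr_ile1 ?abs_ge0. Qed.

Lemma absB_le1 x y : v x <= 1 -> v y <= 1 -> v (x - y) <= 1.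
Proof. by move=> x1 y1; rewrite (le_trans (absB _ _ _)) // ge_max x1. Qed.

(** The columns of all elements of H generate a lattice that H preserves.
    Gaussian elimination over the valuation ring gives it a basis: first a
    generator e with the largest first coordinate, then, once the first
    coordinate is cleared with e, a remainder with the largest second coordinate.
    The maximality of these two pivots makes all coordinates integral.  Dividing
    the basis by a square root of its determinant changes no conjugate. *)
Lemma finite_invariant_lattice (H : set 'M[K]_2) :
  (forall x : K, exists y, y ^+ 2 = x) ->
  finite_set H -> H 1 -> (forall A B, H A -> H B -> H (A * B)) ->
  exists2 P : 'M[K]_2, \det P = 1 & forall A, H A ->
    exists2 B : 'M[K]_2, forall i j, v (B i j) <= 1 & A * P = P * B.
Proof.
move=> sqrtK finH H1 HM.
pose S : set 'cV[K]_2 := (col 0 @` H) `|` (col 1 @` H).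
have finS : finite_set S by rewrite finite_setU; split; apply: finite_image.
have S0 : S (col 0 1) by left; exists 1.
have S1 : S (col 1 1) by right; exists 1.
have HS A w : H A -> S w -> S (A *m w).
  by move=> HA [|] [B HB <-]; rewrite colE mulmxA -colE; [left|right];
    exists (A * B) => //; apply: HM.
have nS : S !=set0 by exists (col 0 1).
have [e Se max_e] := finite_argmax (fun w : 'cV[K]_2 => v (w 0 0)) finS nS.
have e0 : e 0 0 != 0.
  rewrite -(abs_eq0 v) gt_eqF // (lt_le_trans ltr01) //.
  by have := max_e _ S0; rewrite !mxE abs1.
pose r (w : 'cV[K]_2) := w 1 0 - w 0 0 / e 0 0 * e 1 0.
have [f Sf max_f] := finite_argmax (fun w => v (r w)) finS nS.
have f0 : r f != 0.
  rewrite -(abs_eq0 v) gt_eqF // (lt_le_trans ltr01) //.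
  by have := max_f _ S1; rewrite /r !mxE /= !mul0r subr0 abs1.
have [s Ds] := sqrtK (e 0 0 * r f).
have s0 : s != 0.
  by apply: contraNneq (mulf_neq0 e0 f0) => s0; rewrite -Ds s0 expr0n.
(* The columns of P are e and f - (f 0 0 / e 0 0) e. *)
pose P := mx2 (e 0 0) 0 (e 1 0) (r f).
exists (s^-1 *: P).
  by rewrite detZ det2 !mx2E mul0r subr0 -Ds -exprMn mulVf ?expr1n.
(* The generator w has coordinates x w and y w in the basis P. *)
move=> A HA; pose x (w : 'cV[K]_2) := w 0 0 / e 0 0; pose y w := r w / r f.
have Sx w : S w -> v (x w) <= 1 by move=> /max_e; apply: abs_div_le1.
have Sy w : S w -> v (y w) <= 1 by move=> /max_f; apply: abs_div_le1.
exists (mx2 (x (A *m e)) (x (A *m f) - x f * x (A *m e))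
            (y (A *m e)) (y (A *m f) - x f * y (A *m e))).
  have SAe := HS _ _ HA Se; have SAf := HS _ _ HA Sf.
  apply: ord2P; apply: ord2P; rewrite mx2E;
    do ?[exact: Sx | exact: Sy | apply: absB_le1 | apply: absM_le1].
rewrite -scalerAr -scalerAl; congr (_ *: _).
have {}f0 : f 1 0 * e 0 0 - f 0 0 * e 1 0 != 0.
  have -> : f 1 0 * e 0 0 - f 0 0 * e 1 0 = r f * e 0 0 by rewrite /r; field.
  by rewrite mulf_neq0.
rewrite /x /y {}/P /r.
by apply: mx2P; rewrite !mul2E !mx2E !mulmx2E; field; rewrite e0.
Qed.

End Lattice.

(** * Good reduction of integral unimodular matrices *)

Section GoodReduction.
Context (R : realType) (K : fieldType) (v : nonarch_abs R K).

Lemma proj_pt_scale (c a b : K) : c != 0 -> proj_pt (c * a) (c * b) = proj_pt a b.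
Proof.
move=> c0; rewrite /proj_pt mulf_eq0 (negPf c0) /=; case: eqVneq => // b0.
by congr Some; field; rewrite b0.
Qed.

Lemma mobius_proj_pt (A : 'M[K]_2) (x y : K) :
  \det A != 0 -> (x, y) != (0, 0) ->
  mobius A (proj_pt x y) = proj_pt (A 0 0 * x + A 0 1 * y) (A 1 0 * x + A 1 1 * y).
Proof.
rewrite det2 => detA xy.
rewrite [proj_pt x y]/proj_pt; have [y0|y0] := eqVneq y 0; rewrite /=.
  rewrite y0 !mulr0 !addr0 ![_ * x]mulrC proj_pt_scale //.
  by apply: contraNneq xy => ->; rewrite y0.
rewrite -(proj_pt_scale _ _ y0) //; congr proj_pt; field; exact: y0.
Qed.

Definition linear_form (T : comNzRingType) (a b : T) : {mpoly T[2]} :=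
  a *: 'X_0 + b *: 'X_1.

Lemma linear_form_homog (T : comNzRingType) (a b : T) :
  linear_form a b \is 1.-homog.
Proof. by rewrite rpredD // rpredZ // dhomogX /= mdeg1. Qed.

Lemma linear_form_eval (T : comNzRingType) (a b : T) x y :
  (linear_form a b).@[pt2 x y] = a * x + b * y.
Proof. by rewrite mevalD !mevalZ !mevalXU. Qed.

Lemma map_linear_form (T U : comNzRingType) (f : {rmorphism T -> U}) (a b : T) :
  map_mpoly f (linear_form a b) = linear_form (f a) (f b).
Proof. by rewrite rmorphD /= !map_mpolyZ !map_mpolyX. Qed.

(** By Cramer's rule both variables are combinations of the two forms, so a common
    factor q divides both variables.  If q were not constant, the cofactors would
    be constants by degree, making the variables proportional. *)
Lemma linear_form_rel_prime (a b c d : K) :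
  a * d - b * c = 1 -> rel_prime (linear_form a b) (linear_form c d).
Proof.
move=> det1 q u w Eu Ew.
have X0 : 'X_0 = q * (d *: u - b *: w).
  rewrite mulrBr -!scalerAr -Eu -Ew !scalerDr !scalerA opprD addrACA -!scalerBl.
  by rewrite [d * a]mulrC det1 scale1r [d * b]mulrC subrr scale0r addr0.
have X1 : 'X_1 = q * (a *: w - c *: u).
  rewrite mulrBr -!scalerAr -Eu -Ew !scalerDr !scalerA opprD addrACA -!scalerBl.
  by rewrite [c * b]mulrC det1 scale1r [a * c]mulrC subrr scale0r add0r.
set p0 := _ - _ in X0; set p1 := _ - _ in X1.
have nz (i : 'I_2) : 'X_i != 0 :> {mpoly K[2]}.
  by apply/eqP => /(congr1 (fun p : {mpoly K[2]} => p@_U_(i)))/eqP;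
     rewrite mcoeffXU eqxx mcoeff0 oner_eq0.
have /andP[q0 p00] : (q != 0) && (p0 != 0).
  by rewrite -negb_or -mulf_eq0 -X0 nz.
have p10 : p1 != 0 by apply: contraNneq (nz 1) => p10; rewrite X1 p10 mulr0.
have [/msize1_polyC Dq|q_gt1] := leqP (msize q) 1.
  have c0 : q@_0 != 0 by rewrite -(mpolyC_eq0 2) -Dq.
  rewrite Dq; apply/unitrP; exists (q@_0)^-1%:MP.
  by rewrite -!mpolyCM mulVf ?mulfV.
have const p i : p != 0 -> 'X_i = q * p -> p = (p@_0)%:MP.
  move=> nzp /(congr1 (fun s : {mpoly K[2]} => msize s)).
  rewrite msizeX mdeg1 msizeM // => sz; apply: msize1_polyC.
  move: sz q_gt1; move: (msize q) (msize p) => m k; lia.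
have Dp0 := const _ _ p00 X0; have Dp1 := const _ _ p10 X1.
have c0 m : 'X_0@_m = q@_m * p0@_0 by rewrite X0 {1}Dp0 mulrC mcoeffCM mulrC.
have c1 m : 'X_1@_m = q@_m * p1@_0 by rewrite X1 {1}Dp1 mulrC mcoeffCM mulrC.
have := c0 U_(1)%MM; rewrite mcoeffXU => /esym/eqP.
rewrite mulf_eq0 => /orP[/eqP qU1|/eqP p0C].
  by have /eqP := c1 U_(1)%MM; rewrite mcoeffXU qU1 mul0r oner_eq0.
by have /eqP := c0 U_(0%R)%MM; rewrite mcoeffXU p0C mulr0 oner_eq0.
Qed.

(** The determinant is 1, which prevents all coefficients from lying in the maximal
    ideal, and it is still 1 in the residue field, where the reduced forms
    therefore have no nontrivial common zero. *)
Lemma good_reduction_integral (A : SL2 K) :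
  (forall i j, v (A i j) <= 1) -> good_reduction v (PSL2_act (\pi_(PSL2 K) A)).
Proof.
move=> intA.
have intP i j : A i j \in integers_pred v by apply: intA.
pose a i j := Integer (intP i j).
exists 1, (linear_form (a 0 0) (a 0 1)), (linear_form (a 1 0) (a 1 1)).
have valE (g : {mpoly (integers v)[2]}) :
  map_mpoly (@int_val _ _ v) g = map_mpoly (val : integers v -> K) g by [].
pose red : {rmorphism integers v -> residue_field v} := \pi_(residue_field v).
have redE (g : {mpoly (integers v)[2]}) :
  map_mpoly (@reduction _ _ v) g = map_mpoly red g by [].
split; first split.
- by split; apply: linear_form_homog.
- rewrite !valE !map_linear_form; apply: linear_form_rel_prime => /=.
  by rewrite -(det_SL2 A) det2.
- have : 1 <= Num.max (v (A 0 0 * A 1 1)) (v (A 0 1 * A 1 0)).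
    by rewrite -{1}(abs1 v) -(det_SL2 A) det2 absB.
  have coefE (b c : integers v) i :
      (linear_form b c)@_U_(i) = b * (0 == i)%:R + c * (1 == i)%:R.
    by rewrite mcoeffD !mcoeffZ !mcoeffXU.
  have eq1 b c : v b <= 1 -> v c <= 1 -> 1 <= v (b * c) -> v b = 1.
    move=> b1 c1; rewrite absM => bc; apply/eqP; rewrite eq_le b1 (le_trans bc) //.
    by rewrite ler_piMr ?abs_ge0.
  rewrite le_max => /orP[/eq1|/eq1] /(_ (intA _ _) (intA _ _)) Av.
    by exists U_(0%R)%MM; left; rewrite coefE mulr1 mulr0 addr0.
  by exists U_(1)%MM; left; rewrite coefE mulr1 mulr0 add0r.
- move=> x y xy; rewrite PSL2_actE mobius_proj_pt ?det_SL2 ?oner_eq0 //.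
  by rewrite !valE !map_linear_form !linear_form_eval.
move=> x y; rewrite !redE !map_linear_form !linear_form_eval.
set b := red _; set c := red _; set d := red _; set e := red _ => E0 E1.
have det1 : b * e - c * d = 1.
  rewrite /b /c /d /e -!rmorphM -rmorphB -(rmorph1 red).
  by congr (red _); apply: val_inj; rewrite /= -(det_SL2 A) det2.
split.
  have -> : x = e * (b * x + c * y) - c * (d * x + e * y) + (1 - (b * e - c * d)) * x.
    by ring.
  by rewrite E0 E1 det1 subrr !mulr0 mul0r subrr addr0.
have -> : y = b * (d * x + e * y) - d * (b * x + c * y) + (1 - (b * e - c * d)) * y.
  by ring.
by rewrite E0 E1 det1 subrr !mulr0 mul0r subrr addr0.
Qed.
End GoodReduction.

(** * Groups with empty limit set *)

Section LimitSet.
Context (R : realType) (K : fieldType) (v : nonarch_abs R K).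
Context (G : set (PSL2 K)).
Hypothesis limG : limit_set v G = set0.

(** Otherwise an injective sequence in the stabilizer of b moves b along a constant
    sequence, which exhibits b as a limit point. *)
Lemma finite_stabilizer (b : P1 K) : finite_set [set g | G g /\ PSL2_act g b = b].
Proof.
apply: contrapT => /infiniteP/card_leP[f].
suff : limit_set v G b by rewrite limG.
pose g n := \val (f (to_setT n)).
have gS n : [set g | G g /\ PSL2_act g b = b] (g n) by exact: set_valP.
exists b, g; split=> [n||]; first by case: (gS n).
  by move=> m n /val_inj/(inj (in_setT _) (in_setT _))/(congr1 val).
rewrite (_ : (fun n => _) = cst 0); first exact: cvg_cst.
apply/funext => n /=; case: (gS n) => _ ->; case: b {f g gS} => //= z.
by rewrite subrr abs0 mul0r.
Qed.

Definition SL2_preimage : set 'M[K]_2 :=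
  [set A | exists2 B : SL2 K, G (\pi_(PSL2 K) B) & A = SL2_val B].

Hypothesis subgroupG : is_subgroup G.

(** An element of PSL2 has only two lifts, so finiteness of stabilizers passes from
    PSL2 to SL2. *)
Lemma tame_SL2_preimage : tame_group SL2_preimage.
Proof.
have [G1 GM GV] := subgroupG.
split.
- by exists 1%g.
- by move=> _ _ [A GA ->] [B GB ->]; exists (A * B)%g; rewrite // -Defs.pi_mul; exact: GM GA GB.
- by move=> _ [A GA ->]; exists (A^-1)%g; rewrite // -Defs.pi_inv; exact: GV GA.
- by move=> _ [A _ ->]; apply: det_SL2.
move=> u u0; pose b := proj_pt (u 0 0) (u 1 0).
have finS := finite_stabilizer b; set S := [set g | _] in finS.
apply: (@sub_finite_set _ _ ([set SL2_val (repr g) | g in S]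
                         `|` [set - SL2_val (repr g) | g in S])); last first.
  by rewrite finite_setU; split; apply: finite_image.
move=> _ [[A GA ->] [c Au]].
have SA : S (\pi_(PSL2 K) A).
  split=> //; rewrite PSL2_actE mobius_proj_pt ?det_SL2 ?oner_eq0 //; last first.
    apply: contra u0 => /eqP[u00 u10]; apply/eqP/matrixP => i j; rewrite (ord1 j) mxE.
    by move: i; apply: ord2P.
  have c0 : c != 0.
    apply: contraNneq u0 => c0; rewrite -(mulKmx (SL2_unit A) u) Au c0.
    by rewrite scale0r mulmx0.
  by rewrite -!mulmx2E Au !mxE proj_pt_scale.
case: (repr_pi A) => DA; [left|right]; exists (\pi_(PSL2 K) A) => //=; rewrite DA //.
by rewrite opprK.
Qed.

End LimitSet.

Theorem theorem1p3 (R : realType) (p : nat) (hp : prime p)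
    (Cp : fieldType) (v : nonarch_abs R Cp) (hCp : is_Cp p v)
    (G : set (PSL2 Cp)) (hG : is_subgroup G) :
  limit_set v G = set0 -> potentially_good_reduction v G.
Proof.
move=> limG; have tameH := tame_SL2_preimage limG hG.
have [ratCp [sqrtCp primCp]] := Cp_closure hCp.
have finH := tame_finite ratCp sqrtCp primCp tameH.
have [P detP intP] := finite_invariant_lattice v sqrtCp finH (tame1 tameH) (tameM tameH).
pose h : SL2 Cp := MkSL2 (introT eqP detP).
exists (\pi_(PSL2 Cp) h); elim/quotW => A GA.
have [B intB AP] : exists2 B : 'M[Cp]_2, forall i j, v (B i j) <= 1 & SL2_val A * P = P * B.
  by apply: intP; exists A.
have -> : ((\pi_(PSL2 Cp) h)^-1 * \pi_(PSL2 Cp) A * \pi_(PSL2 Cp) h)%g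
    = \pi_(PSL2 Cp) (h^-1 * A * h)%g.
  by rewrite -!Defs.pi_mul -Defs.pi_inv.
apply: good_reduction_integral => i j.
rewrite (_ : SL2_val _ = B) //=.
by rewrite -mulmxA [_ *m P]AP; apply: (mulKmx (SL2_unit h)).
Qed.
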